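(* Fix $\alpha>1$ and let $\rho=\rho_n=1-\frac{2\alpha}{n}$. Then the fraction of functions $f:\{-1,1\}^n\to\{-1,1\}$ (among all $2^{2^n}$ such functions) that are $\rho$-SP is at most $\exp\left(-2^{n\cdot h\left(\frac{\alpha-1}{2\alpha}\right)+o(n)}\right)$ as $n\to\infty$.
   Context: $h(t)=-t\log_2 t-(1-t)\log_2(1-t)$ is the binary entropy function. For $\rho\in[0,1]$, $T_\rho f(y^n)=\mathbb{E}[f(X^n)\mid Y^n=y^n]$ where $X^n$ is uniform on $\{-1,1\}^n$ and $Y^n$ is obtained by flipping each coordinate of $X^n$ independently with probability $(1-\rho)/2$. $\operatorname{sgn}(0)=0$. $f$ is $\rho$-SP if $f(y^n)=\operatorname{sgn}T_\rho f(y^n)$ for all $y^n$ with $T_\rho f(y^n)\neq0$. *)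

(* Defs.v *)
From HB Require Import structures.
From mathcomp Require Import all_boot all_order all_algebra.
From mathcomp Require Import all_classical all_reals all_analysis.

Set Implicit Arguments.
Unset Strict Implicit.
Unset Printing Implicit Defensive.

Import Order.TTheory GRing.Theory Num.Theory.
Import numFieldNormedType.Exports.

Local Open Scope classical_set_scope.
Local Open Scope ring_scope.

(* A sign is encoded by a boolean: b stands for (-1) ^+ b, so that false is 1,
   true is -1, and the product of signs is the exclusive or. *)
Definition cube (n : nat) : finType := {ffun 'I_n -> bool}.
Definition boolfun (n : nat) : finType := {ffun cube n -> bool}.

Section SelfPredicting.
Context {R : realType}.

Definition log2 (x : R) : R := ln x / ln 2.

(* At the endpoints t = 0, 1 the convention ln 0 = 0 gives the usual value 0. *)
Definition binary_entropy (t : R) : R :=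
  - t * log2 t - (1 - t) * log2 (1 - t).

Definition signval (b : bool) : R := (-1) ^+ b.

(* The sample space consists of the pairs w = (x, z), where x is the value of
   X^n and z i tells whether coordinate i is flipped; X^n is uniform, the flips
   are independent of X^n and of each other, of probability (1 - rho) / 2. *)
Definition outcome_prob (n : nat) (rho : R) (w : cube n * cube n) : R :=
  (#|cube n|%:R)^-1 *
  \prod_(i < n) (if w.2 i then (1 - rho) / 2 else 1 - (1 - rho) / 2).

Definition Xn (n : nat) (w : cube n * cube n) : cube n := w.1.
Definition Yn (n : nat) (w : cube n * cube n) : cube n :=
  [ffun i => w.1 i (+) w.2 i].

(* E[f(X^n) | Y^n = y]; the denominator P(Y^n = y) is always 2^-n. *)
Definition noise_op (n : nat) (rho : R) (f : boolfun n) (y : cube n) : R :=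
  (\sum_(w : cube n * cube n | Yn w == y) outcome_prob rho w * signval (f (Xn w)))
  / (\sum_(w : cube n * cube n | Yn w == y) outcome_prob rho w).

Definition is_SP (n : nat) (rho : R) (f : boolfun n) : bool :=
  [forall y : cube n, (noise_op rho f y != 0) ==>
     (signval (f y) == Num.sg (noise_op rho f y))].

Definition SP_fraction (n : nat) (rho : R) : R :=
  #|[set f : boolfun n | is_SP rho f]%SET|%:R / #|boolfun n|%:R.

End SelfPredicting.

(* Main.v *)
Require Import Defs.
From HB Require Import structures.
From mathcomp Require Import all_boot all_order all_algebra.
From mathcomp Require Import all_classical all_reals all_analysis.
From mathcomp Require Import ring lra zify.

(* Let d = alpha / n be the flip probability. A function f is not SP as soon as
   sum_z P(flips = z) f(y) f(y + z) < 0 for some y. The terms with |z| = 0 and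
   |z| = 1 contribute about e^-alpha (1 + alpha (1 - 2 m / n)), where m is the
   number of neighbours of y on which f disagrees with f(y). This is negative
   when m / n exceeds (alpha + 1) / (2 alpha) by a fixed margin; the terms with
   |z| > k are below that margin for a large constant k, and those with
   2 <= |z| <= k sum to a nonpositive number with conditional probability at
   least 1/2, by symmetry. Hence f fails at y with probability at least
   C(n, m) / 2^(n+1), because of an event which depends only on the values of f
   on the ball of radius k around y. These events are independent along a code
   of minimum distance 2 k + 1, which can be chosen of size at least
   2^n / (n+1)^(2k), so f is SP with probability at most
   exp (- C(n, m) / (2 (n+1)^(2k))). The entropy lower bound on C(n, m) and the
   continuity of h conclude. *)

Set Implicit Arguments.
Unset Strict Implicit.
Unset Printing Implicit Defensive.

Import Order.TTheory GRing.Theory Num.Theory.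
Import numFieldNormedType.Exports.

Local Open Scope ring_scope.

(** * Events on a uniform random function that read disjoint sets of values *)

Section Independence.
Context {R : realType} {T S : finType}.
Implicit Types (B : {set T}) (f g : {ffun T -> S}) (a b : pred {ffun T -> S}).

Definition ffun_prob a : R := #|[set f | a f]|%:R / #|{ffun T -> S}|%:R.

Definition depends_on B a := forall f g, {in B, f =1 g} -> a f = a g.

Definition merge B (p : {ffun T -> S} * {ffun T -> S}) : {ffun T -> S} :=
  [ffun x => if x \in B then p.1 x else p.2 x].

(** Exchanging the values outside [B] between two functions is an involution on pairs [(f, g)]. It
    matches the pairs with [a f] and [b f] to those with [a f] and [b g]. *)
Lemma card_depends_on_disjoint B a b :
  depends_on B a -> depends_on (~: B) b ->
  (#|[set f | a f && b f]| * #|{ffun T -> S}| =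
   #|[set f | a f]| * #|[set f | b f]|)%N.
Proof.
move=> aB bB; rewrite -cardsT -!cardsX.
pose swap (p : {ffun T -> S} * {ffun T -> S}) :=
  (merge B p, merge B (p.2, p.1)).
have swapK : involutive swap.
  by move=> [f g]; congr pair; apply/ffunP => x; rewrite !ffunE /= ?ffunE /=;
    case: (x \in B).
rewrite -(card_imset _ (can_inj swapK)) (can_imset_pre _ swapK).
apply: eq_card => -[f g]; rewrite !inE /= andbT; congr andb.
  by apply: aB => x xB; rewrite ffunE xB.
by apply: bB => x; rewrite inE ffunE => /negbTE->.
Qed.

(** By induction on [s]: disjointness makes the events of the tail depend only on values outside
    [B i], so the counting identity splits off the head. *)
Lemma ffun_prob_all (I : Type) (B : I -> {set T})
    (a : I -> pred {ffun T -> S}) (s : seq I) :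
  (0 < #|S|)%N -> (forall i, depends_on (B i) (a i)) ->
  pairwise (fun i j => [disjoint B i & B j]) s ->
  ffun_prob (fun f => all (a^~ f) s) = \prod_(i <- s) ffun_prob (a i).
Proof.
move=> S_gt0 aB; have ST_neq0 : #|{ffun T -> S}|%:R != 0 :> R.
  by rewrite pnatr_eq0 card_ffun -lt0n expn_gt0 S_gt0.
elim: s => [_|i s IHs] /=.
  by rewrite big_nil /ffun_prob cardsE divff.
case/andP => disj /IHs{}IHs; rewrite big_cons -IHs /ffun_prob.
have bB : depends_on (~: B i) (fun f => all (a^~ f) s).
  move=> f g fg; elim: s disj {IHs} => //= j s IHs /andP[disj /IHs->].
  congr andb; apply: aB => x xj; apply: fg.
  by rewrite inE; apply/negP => xi; rewrite (disjointFr disj xi) in xj.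
have /(congr1 (fun m => m%:R : R)) := card_depends_on_disjoint (aB i) bB.
rewrite !natrM => eq_ab.
by rewrite mulf_div -eq_ab -mulf_div divff ?mulr1.
Qed.

End Independence.

(** * Hamming balls and codes in the cube *)

Section Cube.
Context {n : nat}.
Implicit Types (x y z : cube n) (f : boolfun n).

(** Addition in the vector space of dimension n over the field with two elements;
    [wt (cube_add x y)] is the Hamming distance. *)
Definition cube_add y z : cube n := [ffun i => y i (+) z i].
Definition wt z : nat := #|[set i | z i]|.
Definition unit_vec (i : 'I_n) : cube n := [ffun j => j == i].

Lemma cube_addK y : involutive (cube_add y).
Proof. by move=> z; apply/ffunP => i; rewrite !ffunE addKb. Qed.

Lemma cube_addC x y : cube_add x y = cube_add y x.
Proof. by apply/ffunP => i; rewrite !ffunE addbC. Qed.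

Lemma wt0P z : reflect (z = [ffun=> false]) (wt z == 0%N).
Proof.
rewrite cards_eq0; apply: (iffP eqP) => [/setP z0|->].
  by apply/ffunP => i; have := z0 i; rewrite !inE ffunE.
by apply/setP => i; rewrite !inE ffunE.
Qed.

Lemma cube_add0 y : cube_add y [ffun=> false] = y.
Proof. by apply/ffunP => i; rewrite !ffunE addbF. Qed.

Lemma wt_unit_vec i : wt (unit_vec i) = 1%N.
Proof.
by rewrite -(cards1 i); apply: eq_card => j; rewrite !inE ffunE.
Qed.

Lemma unit_vec_inj : injective unit_vec.
Proof.
move=> i j /ffunP/(_ i); rewrite !ffunE eqxx => /esym/eqP. by [].
Qed.

Lemma wt1P z : reflect (exists i, z = unit_vec i) (wt z == 1%N).
Proof.
apply: (iffP cards1P) => [[i /setP zi]|[i ->]]; exists i.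
  by apply/ffunP => j; have := zi j; rewrite !inE ffunE.
by apply/setP => j; rewrite !inE ffunE.
Qed.

Lemma wt_cube_add x y : (wt (cube_add x y) <= wt x + wt y)%N.
Proof.
apply: leq_trans (leq_card_setU [set i | x i] [set i | y i]);
  apply/subset_leq_card/fintype.subsetP => i.
by rewrite !inE ffunE; case: (x i).
Qed.

Definition hball r y : {set cube n} := [set x | (wt (cube_add y x) <= r)%N].

Lemma mem_hball_cube_add r y z : (cube_add y z \in hball r y) = (wt z <= r)%N.
Proof. by rewrite inE cube_addK. Qed.

Lemma wt0 : wt [ffun=> false] = 0%N.
Proof. by apply/eqP/wt0P. Qed.

Lemma hball_center r y : y \in hball r y.
Proof. by have := mem_hball_cube_add r y [ffun=> false];
  rewrite cube_add0 wt0. Qed.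

Lemma hball_disjoint r x y :
  (r.*2 < wt (cube_add x y))%N -> [disjoint hball r x & hball r y].
Proof.
move=> rxy; apply/pred0P => z /=; apply/negbTE/negP;
  rewrite !inE => /andP[xz yz].
have := wt_cube_add (cube_add x z) (cube_add y z).
rewrite (_ : cube_add (cube_add x z) _ = cube_add x y); first by lia.
by apply/ffunP => i; rewrite !ffunE; case: (x i); case: (y i); case: (z i).
Qed.

(** A set of size at most r + 1 arises from one of size at most r by adding one element or none,
    which leaves n + 1 choices per step. *)
Lemma card_small_sets r : (#|[set D : {set 'I_n} | (#|D| <= r)%N]| <=
  n.+1 ^ r)%N.
Proof.
elim: r => [|r IHr].
  rewrite expn0 -(cards1 (@finset.set0 'I_n));
    apply/subset_leq_card/fintype.subsetP => D.
  by rewrite !inE leqn0 cards_eq0.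
pose add (p : option 'I_n * {set 'I_n}) :=
  if p.1 is Some i then i |: p.2 else p.2.
have := leq_imset_card add (finset.setX [set: option 'I_n]
                       [set D : {set 'I_n} | (#|D| <= r)%N]).
rewrite cardsX cardsT card_option card_ord => le_add.
rewrite expnS; apply: leq_trans (leq_mul (leqnn _) IHr).
apply: leq_trans le_add; apply/subset_leq_card/fintype.subsetP => D;
  rewrite inE => Dr.
have [->|[i iD]] := set_0Vmem D.
  by apply/imsetP; exists (None, finset.set0); rewrite ?inE ?cards0.
apply/imsetP; exists (Some i, D :\ i); last by rewrite /add /= finset.setD1K.
by rewrite !inE /=; move: Dr; rewrite (cardsD1 i) iD.
Qed.

Lemma card_hball r y : (#|hball r y| <= n.+1 ^ r)%N.
Proof.
apply: leq_trans (card_small_sets r).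
pose supp x := [set i | cube_add y x i].
have supp_inj : injective supp.
  move=> x x' /setP eqx; apply: (can_inj (cube_addK y)).
  by apply/ffunP => i; have := eqx i; rewrite !inE.
rewrite -(card_imset _ supp_inj); apply/subset_leq_card/fintype.subsetP => D.
by case/imsetP => x; rewrite !inE => xr ->.
Qed.

(** Gilbert-Varshamov argument: the balls of radius r around an inclusion-maximal code cover the
    cube, since an uncovered point could be added to the code. *)
Lemma exists_code r : exists s : seq (cube n),
  pairwise (fun x y => (r < wt (cube_add x y))%N) s /\ (2 ^ n <=
    size s * n.+1 ^ r)%N.
Proof.
pose code (C : {set cube n}) :=
  [forall x in C, forall y in C, (x != y) ==> (r < wt (cube_add x y))%N].
have code0 : code finset.set0 by apply/forall_inP => x; rewrite inE.
have [C /maxsetP[/forall_inP Ccode Cmax] _] := maxset_exists code0.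
exists (enum C); split.
  have : uniq (enum C) by rewrite enum_uniq.
  have : {subset enum C <= C} by move=> x; rewrite mem_enum.
  elim: (enum C) => //= x s IHs sC /andP[xs us].
  rewrite IHs ?andbT //; last by move=> y ys; apply: sC; rewrite inE ys orbT.
  apply/allP => y ys; have xC : x \in C by apply: sC; rewrite inE eqxx.
  have yC : y \in C by apply: sC; rewrite inE ys orbT.
  have /forall_inP/(_ _ yC)/implyP := Ccode _ xC; apply.
  by apply: contraNneq xs => ->.
rewrite -cardE; have <- : #|cube n| = (2 ^ n)%N.
  by rewrite card_ffun card_bool card_ord.
have cover : [set: cube n] \subset \bigcup_(x in C) hball r x.
  apply/fintype.subsetP => y _; apply/bigcupP;
    case: (boolP (y \in C)) => [yC|yC].
    by exists y; rewrite ?hball_center.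
  apply: contrapT => nocover; have far x : x \in C -> (r < wt (cube_add x y))%N.
    by move=> xC; rewrite ltnNge; apply/negP => xy; apply: nocover; exists x;
      rewrite ?inE.
  have codeC : code (y |: C).
    apply/forall_inP => x; rewrite !inE => /orP[/eqP->|xC];
      apply/forall_inP => x';
      rewrite !inE => /orP[/eqP->|xC']; apply/implyP => xx' //.
    - by rewrite eqxx in xx'.
    - by rewrite cube_addC far.
    - exact: far.
    - by have /forall_inP/(_ _ xC')/implyP := Ccode _ xC; apply.
  by have := Cmax _ codeC (finset.subsetUr _ _) => CE;
    rewrite -CE !inE eqxx in yC.
rewrite -cardsT; apply: leq_trans (subset_leq_card cover) _.
rewrite -sum_nat_const;
  apply: leq_trans (leq_sum _ (fun x _ => card_hball r x)).
apply: (big_ind2 (fun (A : {set cube n}) m => #|A| <= m)%N); rewrite ?cards0 //.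
move=> A1 m1 A2 m2 h1 h2; apply: leq_trans (leq_card_setU A1 A2) _.
exact: leq_add.
Qed.

End Cube.

(** * A local event that makes f fail at y, and its probability *)

Section BadEvent.
Context {R : realType} {n : nat}.
Implicit Types (d : R) (k m : nat) (y z : cube n) (f : boolfun n).

Definition flip_prob d z : R := \prod_(i < n) (if z i then d else 1 - d).

Definition agreement f y z : R := signval (f y) * signval (f (cube_add y z)).

Definition disagree f y : {set 'I_n} :=
  [set i | f (cube_add y (unit_vec i)) != f y].

Definition mid_sum d k f y : R :=
  \sum_(z | (1 < wt z <= k)%N) flip_prob d z * agreement f y z.

(** Only the sign of [mid_sum] is prescribed, because a symmetry controls it without any estimate of
    its size. *)
Definition bad_event d k m y f : bool :=
  (#|disagree f y| == m) && (mid_sum d k f y <= 0).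

Lemma bad_event_depends_on d k m y :
  (0 < k)%N -> depends_on (hball k y) (bad_event d k m y).
Proof.
move=> k_gt0 f g fg.
have fgz z : (wt z <= k)%N -> f (cube_add y z) = g (cube_add y z).
  by move=> zk; apply: fg; rewrite mem_hball_cube_add.
have fgy : f y = g y.
  by apply: fg; rewrite hball_center.
have fgD : disagree f y = disagree g y.
  by apply/setP => i; rewrite !inE fgy fgz // wt_unit_vec.
suff fgS : mid_sum d k f y = mid_sum d k g y by rewrite /bad_event fgD fgS.
by apply: eq_bigr => z /andP[_ zk]; rewrite /agreement fgy fgz.
Qed.

Definition toggle (A : {set cube n}) f : boolfun n :=
  [ffun x => f x (+) (x \in A)].

Lemma toggleK A : involutive (toggle A).
Proof. by move=> f; apply/ffunP => x; rewrite !ffunE addbK. Qed.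

(** The set of disagreeing neighbours is uniform among all sets of coordinates: toggling f at the
    neighbours indexed by D changes it by symmetric difference with D, so all fibers have the same
    size. *)
Lemma card_disagree_eq y m :
  (#|[set f | #|disagree f y| == m]| * 2 ^ n = 'C(n, m) * #|boolfun n|)%N.
Proof.
pose fiber D := #|[set f | disagree f y == D]|.
have fiberE D : fiber D = fiber finset.set0.
  pose A := [set cube_add y (unit_vec i) | i in D].
  rewrite /fiber -(card_imset _ (can_inj (toggleK A))) (can_imset_pre _
    (toggleK A)).
  apply: eq_card => f; rewrite !inE.
  have yA : (y \in A) = false.
    apply/negP => /imsetP[i _ /ffunP/(_ i)].
    by rewrite !ffunE eqxx addbT; case: (y i).
  have memA i : (cube_add y (unit_vec i) \in A) = (i \in D).
    by apply: mem_imset; apply: inj_comp (can_inj (cube_addK y)) unit_vec_inj.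
  have disagreeE : disagree (toggle A f) y =i [pred i | (i \in disagree f y)
    (+) (i \in D)].
    move=> i; rewrite !inE !ffunE yA addbF memA.
    by case: (f _); case: (f _); case: (i \in D).
  apply/eqP/eqP => [fD|f0].
    apply/setP => i; have := disagreeE i; rewrite fD !inE => /esym.
    by case: (_ != _); case: (i \in D).
  by apply/setP => i; rewrite disagreeE f0 !inE.
have count P : #|[set f | P (disagree f y)]| =
  (#|[set D : {set 'I_n} | P D]| * fiber finset.set0)%N.
  rewrite -sum1_card (partition_big (fun f => disagree f y) P) /=; last first.
    by move=> f; rewrite inE.
  rewrite -sum_nat_const [RHS](eq_bigl P); last by move=> D; rewrite inE.
  apply: eq_bigr => D PD; rewrite -(fiberE D) /fiber -sum1_card;
    apply: eq_bigl => f.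
  by rewrite !inE; case: eqP => [->|//]; rewrite ?PD ?andbF.
rewrite (count (fun D => #|D| == m)) card_draws card_ord -mulnA; congr muln.
(* The trivial predicate shows that [#|boolfun n|] is 2^n times the common fiber size. *)
have := count predT; rewrite cardsE => ->; rewrite mulnC; congr muln.
have <- : #|powerset [set: 'I_n]| =
  (2 ^ n)%N by rewrite card_powerset cardsT card_ord.
by apply: eq_card => D; rewrite powersetE finset.subsetT inE.
Qed.

Lemma mid_sum_toggle d k f y :
  mid_sum d k (toggle (~: hball 1 y) f) y = - mid_sum d k f y.
Proof.
rewrite /mid_sum -sumrN; apply: eq_bigr => z /andP[z1 _];
  rewrite /agreement !ffunE.
have -> : (y \in ~: hball 1 y) = false by rewrite inE hball_center.
rewrite inE mem_hball_cube_add -ltnNge z1 addbF addbT /signval signrN.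
by rewrite !mulrN.
Qed.

(* Toggling f outside the radius 1 ball around y keeps the set of disagreeing
   neighbours and negates mid_sum, so mid_sum <= 0 costs at most a factor 2. *)
Lemma card_bad_event d k m y :
  ('C(n, m) * #|boolfun n| <= 2 ^ n.+1 * #|[set f | bad_event d k m y f]|)%N.
Proof.
rewrite -(card_disagree_eq y) mulnC expnSr -mulnA leq_mul2l; apply/orP; right.
set E := [set f | bad_event _ _ _ _ f]; set t := toggle (~: hball 1 y).
have sub : [set f | #|disagree f y| == m] \subset E :|: t @: E.
  apply/fintype.subsetP => f;
    rewrite /t (can_imset_pre _ (toggleK _)) !inE => fm.
  rewrite /bad_event fm mid_sum_toggle oppr_le0.
  suff -> : disagree (toggle (~: hball 1 y) f) y = disagree f y by rewrite fm;
    apply: le_total.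
  apply/setP => i; rewrite !inE !ffunE !(finset.in_setC, mem_hball_cube_add,
    hball_center).
  by rewrite wt_unit_vec !addbF.
apply: leq_trans (subset_leq_card sub) _.
apply: leq_trans (leq_card_setU E (t @: E)) _.
by rewrite mul2n -addnn leq_add2l leq_imset_card.
Qed.

End BadEvent.

(** * The noise operator as a sum over flip patterns, split by weight *)

Section Noise.
Context {R : realType} {n : nat}.
Implicit Types (d : R) (k m : nat) (y z : cube n) (f : boolfun n).

Lemma prod_cube (a b : R) z :
  \prod_(i < n) (if z i then a else b) = a ^+ wt z * b ^+ (n - wt z).
Proof.
rewrite (bigID [pred i | z i]) /=; congr (_ * _).
  rewrite (eq_bigr (fun=> a)) => [|i ->//].
  by rewrite prodr_const; congr (_ ^+ _); apply: eq_card => i; rewrite inE.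
rewrite (eq_bigr (fun=> b)) => [|i /negbTE->//].
rewrite prodr_const -[n in (n - _)%N]card_ord -(cardsC [set i | z i]) addKn.
by congr (_ ^+ _); apply: eq_card => i; rewrite !inE.
Qed.

(** Used with a + b = 1 for the total probability, and with a = 2 d, b = 1 - d for the mean of 2 ^
    wt. *)
Lemma sum_prod_cube (a b : R) :
  \sum_(z : cube n) \prod_(i < n) (if z i then a else b) = (a + b) ^+ n.
Proof.
rewrite -(bigA_distr_bigA (fun (_ : 'I_n) (c : bool) => if c then a else b)).
by rewrite (eq_bigr (fun=> a + b)) ?prodr_const ?card_ord// => i _;
  rewrite big_bool.
Qed.

Lemma flip_prob_ge0 d z : 0 <= d <= 1 -> 0 <= flip_prob d z.
Proof.
by move=> /andP[d0 d1]; apply: prodr_ge0 => i _; case: (z i); rewrite ?subr_ge0.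
Qed.

(* Markov's inequality for 2 ^ wt z, using k + 1 <= 2 ^ (k + 1). *)
Lemma flip_prob_tail d k : 0 <= d <= 1 ->
  \sum_(z : cube n | (k < wt z)%N) flip_prob d z <= expR (n%:R * d) / k.+1%:R.
Proof.
move=> d01; rewrite ler_pdivlMr ?ltr0n// mulr_suml.
apply: (@le_trans _ _ (\sum_(z : cube n) \prod_(i < n) (if z i then 2 * d else
  1 - d))).
  rewrite [leRHS](bigID (fun z => (k < wt z)%N)) /=.
  rewrite -[leLHS]addr0; apply: lerD; last first.
    apply: sumr_ge0 => z _; apply: prodr_ge0 => i _.
    by case: (z i); rewrite ?subr_ge0; case/andP: d01 => // d0 _;
      rewrite mulr_ge0.
  apply: ler_sum => z kz;
    rewrite /flip_prob !prod_cube exprMn -[leRHS]mulrA [leLHS]mulrC.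
  apply: ler_wpM2r; first by rewrite -prod_cube; apply: flip_prob_ge0.
  by rewrite -natrX ler_nat; rewrite (leq_trans kz) // ltnW // ltn_expl.
rewrite sum_prod_cube expRM_natl; apply: lerXn2r; rewrite ?nnegrE ?expR_ge0//.
  by case/andP: d01 => ? ?; lra.
by rewrite (le_trans _ (expR_ge1Dx d))//; lra.
Qed.

Lemma sum_wt1 (F : cube n -> R) :
  \sum_(z | wt z == 1%N) F z = \sum_(i < n) F (unit_vec i).
Proof.
rewrite -(big_imset (h := unit_vec) (A := predT) F) /=;
  last by move=> ? ? _ _; apply: unit_vec_inj.
by apply: eq_bigl => z; apply/wt1P/imsetP => [[i ->]|[i _ ->]]; exists i.
Qed.

Lemma sum_agreement_neighbours f y :
  \sum_(i < n) agreement f y (unit_vec i) = n%:R - 2 * #|disagree f y|%:R :> R.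
Proof.
rewrite (eq_bigr (fun i => 1 - 2 * (i \in disagree f y)%:R)); last first.
  move=> i _; rewrite inE /agreement /signval.
  by case: (f y); case: (f _) => /=; lra.
rewrite sumrB sumr_const card_ord -mulr_sumr; congr (_ - 2 * _).
by rewrite -sum1_card natr_sum [RHS]big_mkcond /=; apply: eq_bigr => i _;
  case: (i \in _).
Qed.

Lemma agreement_le1 f y z : agreement f y z <= 1 :> R.
Proof. by rewrite /agreement /signval; case: (f y); case: (f _) => /=; lra. Qed.

(** The three summands of the hypothesis come from weight 0, weight 1 and weights above k; the
    weights from 2 to k contribute [mid_sum]. *)
Lemma bad_event_sum_lt0 d k m y f : (0 < k)%N -> 0 < d < 1 ->
  (1 - d) ^+ n + d * (1 - d) ^+ n.-1 * (n%:R - 2 * m%:R)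
    + expR (n%:R * d) / k.+1%:R < 0 ->
  bad_event d k m y f ->
  \sum_z flip_prob d z * agreement f y z < 0.
Proof.
move=> k_gt0 /andP[d0 d1] lt0 /andP[/eqP fm mid]; apply: le_lt_trans lt0.
have d01 : 0 <= d <= 1 by rewrite !ltW.
rewrite (bigD1 [ffun=> false]) //= (bigID (fun z => wt z == 1%N)) /=.
rewrite [X in _ + (_ + X)](bigID (fun z => wt z <= k)%N) /=.
(* The added 0 is the bound on [mid_sum]. *)
rewrite !addrA -[leRHS]addr0 -!addrA; apply: lerD.
  rewrite /flip_prob prod_cube wt0 expr0 mul1r subn0 /agreement cube_add0.
  by rewrite /signval; case: (f y) => /=; lra.
apply: lerD.
  rewrite (eq_bigl (fun z => wt z == 1%N)); last first.
    by move=> z; case: (wt z =P 1%N) => z1; rewrite ?andbF ?andbT //;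
      apply: contra_eqN z1 => /eqP->; rewrite wt0.
  rewrite sum_wt1 (eq_bigr (fun i =>
    d * (1 - d) ^+ n.-1 * agreement f y (unit_vec i))).
    by rewrite -mulr_sumr sum_agreement_neighbours fm.
  by move=> i _; rewrite /flip_prob prod_cube wt_unit_vec subn1.
rewrite addrC; apply: lerD.
  rewrite (eq_bigl (fun z => k < wt z)%N); last first.
    move=> z; rewrite -ltnNge; case: ltnP => kz; rewrite ?andbF // andbT.
    apply/andP; split; last by lia.
    by apply: contraTneq kz => ->; rewrite wt0.
  apply: le_trans (flip_prob_tail k d01); apply: ler_sum => z _.
  by rewrite ler_piMr ?flip_prob_ge0 ?agreement_le1.
rewrite (eq_bigl (fun z => 1 < wt z <= k)%N) // => z.
case: (wt z <= k)%N; rewrite ?andbT ?andbF //.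
by rewrite (sameP eqP (wt0P z)); lia.
Qed.

(** The outcomes with Y^n = y are the pairs [(cube_add y z, z)]; the uniform weight of X^n cancels
    against the denominator. *)
Lemma noise_opE (rho : R) f y :
  noise_op rho f y =
  \sum_z flip_prob ((1 - rho) / 2) z * signval (f (cube_add y z)).
Proof.
rewrite /noise_op.
have sumY (G : cube n * cube n -> R) :
    \sum_(w | Yn w == y) G w = \sum_z G (cube_add y z, z).
  rewrite (reindex_onto (fun z => (cube_add y z, z)) snd) /=; last first.
    move=> [x z] /eqP <-; congr pair; apply/ffunP => i.
    by rewrite !ffunE /= addbK.
  apply: eq_bigl => z; rewrite eqxx andbT; apply/eqP/ffunP => i.
  by rewrite !ffunE addbK.
rewrite !sumY /outcome_prob /= -!mulr_sumr sum_prod_cube.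
set d := (1 - rho) / 2.
have -> : d + (1 - d) = 1 by ring.
rewrite expr1n mulr1 -[in LHS](eq_bigr _ (fun z _ => mulrA _ _ _)) -mulr_sumr.
rewrite mulrC mulKf // invr_eq0 pnatr_eq0 card_ffun card_bool.
by rewrite -lt0n expn_gt0.
Qed.

(** The sum is f(y) times the noise operator at y, which for an SP function is the absolute value of
    the latter. *)
Lemma is_SP_sum_ge0 (rho : R) f y : is_SP rho f ->
  0 <= \sum_z flip_prob ((1 - rho) / 2) z * agreement f y z.
Proof.
move=> /forallP/(_ y)/implyP SP.
have -> : \sum_z flip_prob ((1 - rho) / 2) z * agreement f y z =
          signval (f y) * noise_op rho f y.
  by rewrite noise_opE mulr_sumr; apply: eq_bigr => z _; rewrite mulrCA.
have [->|/SP/eqP->] := eqVneq (noise_op rho f y) 0; first by rewrite mulr0.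
by rewrite -normrEsg.
Qed.

End Noise.

(** * The bound for fixed n, from independence along a code *)

Lemma SP_fraction_le (R : realType) (n k m : nat) (d : R) :
  (0 < k)%N -> 0 < d < 1 ->
  (1 - d) ^+ n + d * (1 - d) ^+ n.-1 * (n%:R - 2 * m%:R)
    + expR (n%:R * d) / k.+1%:R < 0 ->
  SP_fraction n (1 - 2 * d) <=
    expR (- ('C(n, m)%:R / (2 * n.+1%:R ^+ k.*2))).
Proof.
move=> k_gt0 d01 lt0.
(* Distances above 2 k make the balls of radius k disjoint. *)
have [s [s_far s_size]] := @exists_code n k.*2.
pose good y (f : boolfun n) := ~~ bad_event d k m y f.
have N_gt0 : 0 < #|boolfun n|%:R :> R.
  by rewrite ltr0n card_ffun card_bool expn_gt0.
have SP_good : SP_fraction n (1 - 2 * d) <= ffun_prob (fun f : boolfun n =>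
  all (good^~ f) s) :> R.
  rewrite /SP_fraction /ffun_prob ler_pM2r ?invr_gt0// ler_nat.
  apply/subset_leq_card/fintype.subsetP => f; rewrite !inE => SP.
  apply/allP => y _; apply/negP => bad.
  have := is_SP_sum_ge0 y SP; rewrite (_ : (1 - _) / 2 = d); last by field.
  by rewrite leNgt (bad_event_sum_lt0 k_gt0 d01 lt0 bad).
apply: le_trans SP_good _.
rewrite (@ffun_prob_all _ _ _ _ (hball k)) ?card_bool //; first last.
- apply: sub_pairwise s_far => x y; exact: hball_disjoint.
- by move=> y f g fg; congr negb; apply: bad_event_depends_on fg.
(* A lower bound on the probability of the bad event at one point; each code point then costs a
   factor 1 - c, at most exp (- c). *)
pose c : R := 'C(n, m)%:R / 2 ^+ n.+1.
have good_le y : ffun_prob (good y) <= expR (- c) :> R.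
  apply: le_trans (expR_ge1Dx _); rewrite /ffun_prob ler_pdivrMr //.
  have := card_bad_event d k m y; rewrite -(ler_nat R) !natrM => bad_ge.
  have -> : #|[set f | good y f]|%:R =
    #|boolfun n|%:R - #|[set f | bad_event d k m y f]|%:R :> R.
    rewrite -(cardsC [set f | bad_event d k m y f]) natrD addrAC subrr add0r.
    by congr (_%:R); apply: eq_card => f; rewrite !inE.
  rewrite mulrDl mul1r lerD2l mulNr lerN2 /c mulrAC ler_pdivrMr ?exprn_gt0//.
  by rewrite [leRHS]mulrC -natrX.
apply: (@le_trans _ _ (\prod_(y <- s) expR (- c))).
  by apply: ler_prod => y _; rewrite good_le andbT divr_ge0.
rewrite big_const_seq count_predT iter_mulr_1 -expRM_natl ler_expR.
rewrite mulrN lerN2 /c.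
have := s_size; rewrite -(ler_nat R) natrM !natrX => size_ge.
rewrite ler_pdivrMr ?mulr_gt0 ?exprn_gt0//.
rewrite exprS (_ : _ * _ * _ =
  'C(n, m)%:R * ((size s)%:R * n.+1%:R ^+ k.*2 / 2 ^+ n)).
  by rewrite ler_peMr // ler_pdivlMr ?exprn_gt0 ?mul1r.
by field; rewrite expf_neq0.
Qed.

Local Open Scope classical_set_scope.

(** * Entropy bounds for binomial coefficients, and growth estimates *)

Section Entropy.

(** Up to the factor n^n, these are the probabilities of j and of m successes in n trials of success
    probability m / n. Comparing consecutive terms shows that they increase up to m and decrease
    afterwards. *)
Lemma binomial_mode (n m j : nat) : (m <= n)%N -> (j <= n)%N ->
  ('C(n, j) * ((n - m) ^ (n - j) * m ^ j) <=
   'C(n, m) * ((n - m) ^ (n - m) * m ^ m))%N.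
Proof.
move=> mn jn; pose t i := ('C(n, i) * ((n - m) ^ (n - i) * m ^ i))%N.
have tS i : (i < n)%N -> (i.+1 * t i.+1 =
  (n - i) * m * ('C(n, i) * ((n - m) ^ (n - i.+1) * m ^ i)))%N.
  by move=> ilt; rewrite /t mulnA mul_bin_left expnS; lia.
have tE i : (i < n)%N -> (i.+1 * t i =
  i.+1 * (n - m) * ('C(n, i) * ((n - m) ^ (n - i.+1) * m ^ i)))%N.
  by move=> ilt; rewrite /t (_ : n - i = (n - i.+1).+1)%N ?expnS; lia.
have up i : (i < m)%N -> (t i <= t i.+1)%N.
  move=> im; have ilt : (i < n)%N by lia.
  by rewrite -(leq_pmul2l (ltn0Sn i)) tS // tE // leq_mul2r; apply/orP; right;
    nia.
have down i : (m <= i < n)%N -> (t i.+1 <= t i)%N.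
  move=> /andP[im ilt].
  by rewrite -(leq_pmul2l (ltn0Sn i)) tS // tE // leq_mul2r; apply/orP; right;
    nia.
rewrite -/(t j) -/(t m); have [jm|mj] := leqP j m.
  have : forall i, (i <= m)%N -> (t (m - i) <= t m)%N.
    elim=> [|i IHi] im; first by rewrite subn0.
    apply: leq_trans (IHi (ltnW im)); rewrite -{2}[i]/(i.+1.-1).
    by rewrite (_ : m - i.+1.-1 = (m - i.+1).+1)%N; [apply: up|]; lia.
  by move=> /(_ (m - j)%N); rewrite subKn //; apply; lia.
have : forall i, (m + i <= n)%N -> (t (m + i) <= t m)%N.
  elim=> [|i IHi] im; first by rewrite addn0.
  by rewrite addnS; apply: leq_trans (down _ _) (IHi _); lia.
by move=> /(_ (j - m)%N); rewrite subnKC; [apply|]; lia.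
Qed.

(** The binomial expansion of ((n - m) + m)^n has n + 1 terms, and the one of index m is the
    largest. *)
Lemma expnn_le_bin (n m : nat) : (m <= n)%N ->
  (n ^ n <= n.+1 * ('C(n, m) * ((n - m) ^ (n - m) * m ^ m)))%N.
Proof.
move=> mn; have -> : (n ^ n = (n - m + m) ^ n)%N by rewrite subnK.
rewrite expnDn; set M := ('C(n, m) * _)%N;
  apply: (@leq_trans (\sum_(j < n.+1) M)%N); last first.
  by rewrite sum_nat_const card_ord.
by apply: leq_sum => j _; apply: binomial_mode => //; rewrite -ltnS.
Qed.

Context {R : realType}.

Lemma powR2E (x : R) : 2 `^ x = expR (x * ln 2).
Proof. by rewrite /powR pnatr_eq0. Qed.

Lemma ln2_gt0 : 0 < ln 2 :> R.
Proof. by rewrite ln_gt0 // ltr1n. Qed.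

Lemma powR_entropy_le_bin (n m : nat) : (0 < m < n)%N ->
  2 `^ (n%:R * binary_entropy (m%:R / n%:R)) <= n.+1%:R * 'C(n, m)%:R :> R.
Proof.
move=> /andP[m_gt0 mn]; have n_gt0 : (0 < n)%N by lia.
have m0 : 0 < m%:R :> R by rewrite ltr0n.
have n0 : 0 < n%:R :> R by rewrite ltr0n.
have nm0 : 0 < (n - m)%:R :> R by rewrite ltr0n subn_gt0.
have nmE : 1 - m%:R / n%:R = (n - m)%:R / n%:R :> R.
  by rewrite natrB ?(ltnW mn)//; field; rewrite gt_eqF.
rewrite powR2E /binary_entropy nmE /log2 !ln_div ?posrE //.
(* Thus 2^(n h(m/n)) equals n^n / ((n - m)^(n - m) m^m). *)
have -> : n%:R * (- (m%:R / n%:R) * ((ln m%:R - ln n%:R) / ln 2)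
    - (n - m)%:R / n%:R * ((ln (n - m)%:R - ln n%:R) / ln 2)) * ln 2
    = n%:R * ln n%:R - (n - m)%:R * ln (n - m)%:R - m%:R * ln m%:R :> R.
  rewrite natrB ?(ltnW mn)//; field.
  by rewrite (gt_eqF n0) (gt_eqF ln2_gt0).
rewrite !expRB !expRM_natl !lnK ?posrE //.
rewrite !ler_pdivrMr ?exprn_gt0 //.
have := expnn_le_bin (ltnW mn); rewrite -(ler_nat R) !natrM !natrX.
by rewrite !mulrA [X in _ -> _ <= X]mulrAC.
Qed.

Lemma binary_entropyC (t : R) : binary_entropy (1 - t) = binary_entropy t.
Proof. by rewrite /binary_entropy subKr; ring. Qed.

Lemma binary_entropy_continuous (p : R) : 0 < p < 1 ->
  {for p, continuous (@binary_entropy R)}.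
Proof.
move=> /andP[p0 p1]; rewrite /binary_entropy /log2.
apply: cvgB; apply: cvgM.
- exact: cvgN.
- by apply: cvgMr_tmp; apply: continuous_ln.
- by apply: cvgB; [apply: cvg_cst|].
- apply: cvgMr_tmp; apply: continuous_comp; first by apply: cvgB;
  [apply: cvg_cst|].
  by apply: continuous_ln; rewrite subr_gt0.
Qed.

Lemma poly_le_expR (K : nat) (c : R) : 0 < c ->
  \forall n \near \oo, 2 * n.+1%:R ^+ K <= expR (n%:R * c).
Proof.
move=> c0.
(* The exponential dominates its term of degree K + 1; for n at least [N] the extra factor n absorbs
   all constants, including the 2^K from n + 1 <= 2 n. *)
pose N : R := 2 ^+ K.+1 * (K.+1)`!%:R / c ^+ K.+1.
near=> n.
have n1 : 1 <= n%:R :> R by near: n; exact: nbhs_infty_ger.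
have nN : N <= n%:R by near: n; exact: nbhs_infty_ger.
have nc0 : 0 <= n%:R * c by rewrite mulr_ge0 // ltW.
have F0 : 0 < (K.+1)`!%:R :> R by rewrite ltr0n fact_gt0.
apply: le_trans (expR_ge1Dxn K nc0);
  apply: (@le_trans _ _ ((n%:R * c) ^+ K.+1 / (K.+1)`!%:R)); last by lra.
rewrite ler_pdivlMr // exprMn.
apply: (@le_trans _ _ (2 * (2 * n%:R) ^+ K * (K.+1)`!%:R)).
  rewrite ler_pM2r // ler_pM2l // lerXn2r ?nnegrE ?mulr_ge0 //.
  by rewrite -natr1; lra.
move: nN; rewrite /N ler_pdivrMr ?exprn_gt0 // => nN.
rewrite [(2 * n%:R) ^+ K]exprMn [n%:R ^+ K.+1]exprSr -[leRHS]mulrA.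
have -> : 2 * (2 ^+ K * n%:R ^+ K) * (K.+1)`!%:R
    = n%:R ^+ K * (2 ^+ K.+1 * (K.+1)`!%:R) :> R by rewrite exprS; ring.
by rewrite ler_wpM2l // exprn_ge0.
Unshelve. all: by end_near.
Qed.

End Entropy.

(** * Choice of the parameters and passage to the o(n) form *)

Section Asymptotics.
Context {R : realType}.

(** On this range (1 - d)(1 + 2 d) >= 1, hence 1 - d >= exp (- 2 d). *)
Lemma expR_le_exprB (d : R) (n : nat) : 0 <= d <= 2^-1 ->
  expR (- (2 * (n%:R * d))) <= (1 - d) ^+ n.
Proof.
move=> /andP[d0 d1]; rewrite mulrCA -mulrN expRM_natl lerXn2r ?nnegrE
  ?expR_ge0 //.
  by lra.
rewrite expRN -[leLHS]mul1r ler_pdivrMr ?expR_gt0 //.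
apply: le_trans (ler_wpM2l _ (expR_ge1Dx (2 * d))); last by lra.
by nra.
Qed.

(** The choice of m gives d (n - 2 m) < - 1 - alpha zeta, so the first two terms sum to at most -
    alpha zeta (1 - d)^n. As (1 - d)^n >= exp (- 2 alpha), the condition on k makes the tail exp
    alpha / (k + 1) smaller than this margin. *)
Lemma bad_event_margin (alpha zeta : R) (n k m : nat) :
  1 < alpha -> 0 < zeta -> 2 * alpha <= n%:R ->
  expR (3 * alpha) < k.+1%:R * (alpha * zeta) ->
  n%:R * ((alpha + 1) / (2 * alpha) + zeta / 2) < m%:R ->
  let d := alpha / n%:R in
  (1 - d) ^+ n + d * (1 - d) ^+ n.-1 * (n%:R - 2 * m%:R)
    + expR (n%:R * d) / k.+1%:R < 0.
Proof.
move=> a1 z0 na kz mgt /=; set d := alpha / n%:R.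
have n0 : 0 < n%:R :> R by lra.
have nd : n%:R * d = alpha by rewrite /d mulrC divfK // gt_eqF.
have d0 : 0 < d by rewrite divr_gt0 //; lra.
have d2 : d <= 2^-1 by rewrite /d ler_pdivrMr //; lra.
have := @expR_le_exprB d n; rewrite nd d2 (ltW d0) => /(_ isT).
set A := (1 - d) ^+ n => Age.
have A0 : 0 < A by apply: lt_le_trans Age; apply: expR_gt0.
have AB : A <= (1 - d) ^+ n.-1.
  by apply: ler_wiXn2l (leq_pred n); lra.
set B := (1 - d) ^+ n.-1 in AB *; set S := n%:R - 2 * m%:R.
have dm : d * S < - 1 - alpha * zeta.
  rewrite /S mulrBr [d * n%:R]mulrC nd.
  have : d * (n%:R * ((alpha + 1) / (2 * alpha) + zeta / 2)) < d * m%:R.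
    by rewrite ltr_pM2l.
  rewrite mulrA [d * n%:R]mulrC nd.
  have -> : alpha * ((alpha + 1) / (2 * alpha) + zeta / 2) =
    (alpha + 1) / 2 + alpha * zeta / 2.
    by field; lra.
  by lra.
have az0 : 0 < alpha * zeta by rewrite mulr_gt0 //; lra.
have BA : d * B * S <= A * (- 1 - alpha * zeta).
  rewrite mulrAC; nra.
have tail : expR alpha / k.+1%:R < A * (alpha * zeta).
  rewrite ltr_pdivrMr ?ltr0n //;
    apply: lt_le_trans (_ : expR (- (2 * alpha)) * (k.+1%:R * (alpha * zeta))
      <= _).
    rewrite expRN mulrC ltr_pdivlMr ?expR_gt0 // -expRD.
    by rewrite (_ : alpha + 2 * alpha = 3 * alpha) //; ring.
  by rewrite -mulrA [alpha * zeta * _]mulrC ler_wpM2r // mulr_ge0 // ltW.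
apply: le_lt_trans (lerD (lerD (lexx A) BA) (lexx _)) _.
by rewrite mulrBr mulrN1 addrA subrr sub0r addrC subr_lt0.
Qed.

Lemma SP_fraction_eventually_le (alpha eps : R) : 1 < alpha -> 0 < eps ->
  \forall n \near \oo, SP_fraction n (1 - 2 * alpha / n%:R) <=
    expR (- (2 `^ (n%:R * (binary_entropy ((alpha - 1) / (2 * alpha)) - eps)))).
Proof.
move=> a1 e0; set H := binary_entropy _.
pose p := (alpha + 1) / (2 * alpha).
have p01 : 0 < p < 1.
  rewrite /p divr_gt0 /=; [|lra|lra].
  by rewrite ltr_pdivrMr; lra.
have HE : binary_entropy p = H.
  by rewrite -binary_entropyC; congr binary_entropy; rewrite /p; field; lra.
(* Half of eps pays for moving m / n away from p, the other half for the polynomial factors. *)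
have : \forall t \near p, H - eps / 2 < binary_entropy t /\ 0 < t < 1.
  near=> t; split.
    near: t; rewrite -HE;
      have /cvgrPdist_lt/(_ (eps / 2)) := binary_entropy_continuous p01.
    move=> /(_ ltac:(lra)); apply: filterS => t; rewrite ltr_norml; lra.
  near: t; have := @near_in_itvoo R 0 1 p; rewrite inE => /(_ p01).
  by apply: filterS => t; rewrite inE.
move=> /nbhs_ballP[zeta /= z0 near_p].
pose k := (Num.truncn (expR (3 * alpha) / (alpha * zeta))).+1.
have az0 : 0 < alpha * zeta by rewrite mulr_gt0 //; lra.
have kz : expR (3 * alpha) < k.+1%:R * (alpha * zeta).
  rewrite -ltr_pdivrMr //; apply: lt_le_trans (truncnS_gt _) _.
  by rewrite ler_nat.
(* Degree 2 k comes from the code, one more from the factor n + 1 in the entropy bound. *)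
have poly := @poly_le_expR R k.*2.+1 (eps / 2 * ln 2).
near=> n.
have na : 2 * alpha <= n%:R by near: n; exact: nbhs_infty_ger.
have nz : 4 / zeta <= n%:R by near: n; exact: nbhs_infty_ger.
have npoly : 2 * n.+1%:R ^+ k.*2.+1 <= expR (n%:R * (eps / 2 * ln 2)).
  by near: n; apply: poly; rewrite mulr_gt0 ?ln2_gt0 //; lra.
have n0 : 0 < n%:R :> R by lra.
pose q := p + zeta / 2.
have q0 : 0 < q by have /andP[? _] := p01; rewrite /q; lra.
(* The least integer above n q: m / n exceeds p by more than zeta / 2, yet stays within zeta of p
   once n >= 4 / zeta. *)
pose m := (Num.truncn (n%:R * q)).+1.
have mgt : n%:R * q < m%:R by apply: truncnS_gt.
have mle : m%:R <= n%:R * q + 1.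
  rewrite /m -natr1 lerD2r.
  by have /andP[] := truncn_itv (ltW (mulr_gt0 n0 q0)).
have mn_ball : ball p zeta (m%:R / n%:R).
  rewrite /ball /= ltr_norml.
  have -> : p - m%:R / n%:R = (n%:R * p - m%:R) / n%:R by field; lra.
  move: nz; rewrite ler_pdivrMr // => nz.
  move: mgt mle; rewrite /q => mgt mle.
  by rewrite ltr_pdivlMr // ltr_pdivrMr //; apply/andP; split; nra.
have [ent mn01] := near_p _ mn_ball.
have m_itv : (0 < m < n)%N.
  by have /andP[_] := mn01; rewrite ltr_pdivrMr // mul1r ltr_nat.
have d01 : 0 < alpha / n%:R < 1.
  by rewrite divr_gt0 ?ltr_pdivrMr //; lra.
have k0 : (0 < k)%N by [].
have := @SP_fraction_le R n k m _ k0 d01 (bad_event_margin a1 z0 na kz mgt).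
rewrite mulrA => /le_trans; apply; rewrite ler_expR lerN2.
have P0 : 0 < n.+1%:R ^+ k.*2 :> R by rewrite exprn_gt0.
rewrite ler_pdivlMr; last by rewrite mulr_gt0.
have n10 : 0 < n.+1%:R :> R by [].
have binC := powR_entropy_le_bin (R := R) m_itv.
rewrite [leRHS]mulrC -ler_pdivrMr // in binC; apply: le_trans binC.
rewrite ler_pdivlMr // -mulrA -[2 * _ * _]mulrA -exprSr.
apply: (@le_trans _ _ (2 `^ (n%:R * (H - eps)) * expR (n%:R * (eps / 2 * ln
  2)))).
  by rewrite ler_wpM2l // powR_ge0.
rewrite !powR2E -expRD ler_expR.
rewrite (_ : _ + _ = n%:R * (H - eps / 2) * ln 2); last by field.
by rewrite ler_wpM2r ?(ltW ln2_gt0) // ler_wpM2l // ltW.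
Unshelve. all: by end_near.
Qed.

Lemma littleo_exponent (a : nat -> R) (H : R) :
  (forall eps, 0 < eps ->
     \forall n \near \oo, a n <= expR (- (2 `^ (n%:R * (H - eps))))) ->
  exists e : nat -> R, (e n / n%:R @[n --> \oo] --> (0 : R))%classic /\
    (\forall n \near \oo, a n <= expR (- (2 `^ (n%:R * H + e n)))).
Proof.
move=> aH.
(* The exact exponent error, capped at 0 so that only e n >= - eps n needs proof; where [a n] is not
   positive the bound is trivial and the value 0 serves. *)
pose e n : R := if a n <=
  0 then 0 else Num.min 0 (log2 (- ln (a n)) - n%:R * H).
have key n eps : a n <= expR (- (2 `^ (n%:R * (H - eps)))) -> 0 < a n ->
    0 < - ln (a n) /\ n%:R * (H - eps) <= log2 (- ln (a n)).
  move=> an a0; have lna : 2 `^ (n%:R * (H - eps)) <= - ln (a n).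
    by rewrite lerNr -ler_expR lnK ?posrE.
  have P0 : 0 < 2 `^ (n%:R * (H - eps)) :> R by rewrite powR_gt0.
  have L0 := lt_le_trans P0 lna; split => //.
  rewrite /log2 ler_pdivlMr ?ln2_gt0 // -ler_expR -powR2E lnK //.
exists e; split.
  apply/cvgr0Pnorm_le => eps eps0; near=> n.
  have n1 : 1 <= n%:R :> R by near: n; exact: nbhs_infty_ger.
  have n0 : 0 < n%:R :> R by lra.
  have an : a n <= expR (- (2 `^ (n%:R * (H - eps)))) by near: n; exact: aH.
  rewrite normrM normfV (gtr0_norm n0) ler_pdivrMr // /e.
  case: (leP (a n) 0) => a0; first by rewrite normr0 mulr_ge0 // ltW.
  have [_ le_log] := key _ _ an a0.
  have en0 : 0 <= eps * n%:R by rewrite mulr_ge0 // ltW.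
  by case: (leP 0 (log2 _ - _)) => h0; rewrite ?normr0 // ltr0_norm //; lra.
(* Any positive eps would do: it only ensures - ln (a n) > 0, so that [log2] can be inverted. *)
have := aH 1 ltr01; apply: filterS => n an; rewrite /e.
case: (leP (a n) 0) => a0; first by rewrite (le_trans a0) // expR_ge0.
have [L0 _] := key _ _ an a0.
rewrite -[leLHS](lnK a0) ler_expR lerNr -[leRHS]lnK ?posrE //.
rewrite powR2E ler_expR -ler_pdivlMr ?ln2_gt0 // -/(log2 _).
by rewrite -lerBrDl ge_min lexx orbT.
Unshelve. all: by end_near.
Qed.

End Asymptotics.

Theorem theorem7p1 (R : realType) (alpha : R) (halpha : 1 < alpha) :
  exists e : nat -> R,
    (e n / n%:R @[n --> \oo] --> (0 : R)) /\
    (\forall n \near \oo,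
       SP_fraction n (1 - 2 * alpha / n%:R)
       <= expR (- (2 `^ (n%:R * binary_entropy ((alpha - 1) / (2 * alpha))
                         + e n)))).
Proof.
by apply: littleo_exponent => eps; apply: SP_fraction_eventually_le.
Qed.
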